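(* Let $\lambda$ be a real number, $\alpha>0$, and let $X$ be a zero-truncated degenerate Poisson random variable with parameter $\alpha$. Then for every positive integer $n$, $$E\big[(X)_{n,\lambda}\big]=\frac{1}{1-e_\lambda^{-1}(\alpha)}\mathrm{Bel}_{n,\lambda}(\alpha).$$
   Context: The $\lambda$-falling factorial is $(x)_{0,\lambda}=1$, $(x)_{n,\lambda}=x(x-\lambda)\cdots(x-(n-1)\lambda)$ for $n\ge1$. The degenerate exponential is $e_\lambda^x(t)=\sum_{n\ge0}(x)_{n,\lambda}\frac{t^n}{n!}$ $(=(1+\lambda t)^{x/\lambda})$, $e_\lambda(t)=e_\lambda^1(t)$, $e_\lambda^{-1}(x)=1/e_\lambda(x)$ (for $\lambda=0$: $e^{xt}$). A zero-truncated degenerate Poisson random variable with parameter $\alpha>0$ is a random variable $X$ with $P\{X=k\}=\frac{1}{e_\lambda(\alpha)-1}\frac{\alpha^k}{k!}(1)_{k,\lambda}$ for $k=1,2,3,\dots$. The degenerate Bell polynomials are defined by $e_\lambda^{-1}(x)e_\lambda\big(xe_\lambda(t)\big)=\sum_{n\ge0}\mathrm{Bel}_{n,\lambda}(x)\frac{t^n}{n!}$, equivalently $\mathrm{Bel}_{n,\lambda}(x)=\frac{1}{e_\lambda(x)}\sum_{k\ge0}\frac{x^k}{k!}(1)_{k,\lambda}(k)_{n,\lambda}$. *)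

(* Defs.v *)
From HB Require Import structures.
From mathcomp Require Import all_boot all_order all_algebra.
From mathcomp Require Import all_classical all_reals all_analysis.
Import Order.TTheory GRing.Theory Num.Theory.
Import numFieldNormedType.Exports.

Set Implicit Arguments.
Unset Strict Implicit.
Unset Printing Implicit Defensive.

Local Open Scope classical_set_scope.
Local Open Scope ring_scope.

Definition dfalling (R : realType) (lambda x : R) (n : nat) : R :=
  \prod_(i < n) (x - i%:R * lambda).

(* e_lambda^x(t), defined by its power series in t, hence meaningful only where
   that series converges; [limn] returns an unspecified value elsewhere. *)
Definition dexpx (R : realType) (lambda x t : R) : R :=
  limn (series (fun n => dfalling lambda x n * (t ^+ n / n`!%:R))).

Definition dexp (R : realType) (lambda t : R) : R := dexpx lambda 1 t.

(* The support clause makes the masses at k = 1, 2, ... the whole law of X.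
   Convergence of the series of e_lambda(alpha) is not assumed: it follows from
   the two clauses, because P has total mass 1. *)
Definition zt_degenerate_poisson (R : realType) (d : measure_display)
    (T : measurableType d) (P : probability T R) (X : {RV P >-> R})
    (lambda alpha : R) : Prop :=
  {ae P, forall w, exists2 k : nat, (0 < k)%N & X w = k%:R} /\
  forall k : nat, (0 < k)%N ->
    P (X @^-1` [set k%:R]) =
    ((dexp lambda alpha - 1)^-1 *
       (alpha ^+ k / k`!%:R * dfalling lambda 1 k))%:E.

Definition dBell_egf (R : realType) (lambda x : R) (b : nat -> R) : Prop :=
  \forall t \near (0 : R),
    series (fun n => b n * (t ^+ n / n`!%:R)) @ \oo -->
      (dexp lambda x)^-1 * dexp lambda (x * dexp lambda t).

(* Such a coefficient sequence is unique when it exists; [xget] selects it and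
   falls back to the zero sequence otherwise. *)
Definition dBell (R : realType) (lambda x : R) : nat -> R :=
  xget (fun=> 0) [set b : nat -> R | dBell_egf lambda x b].

(* Main.v *)
(* Write c_k for (1)_{k,lambda} alpha^k / k!. The masses of X are C c_k with
   C = 1 / (e_lambda(alpha) - 1); being nonnegative with sum 1, they force C > 0,
   c_k >= 0 and the convergence of sum c_k. This in turn forces sum c_k D^k to
   converge for some D > 1: if lambda > 0 then the c_k vanish eventually, and if
   lambda <= 0 then |lambda| alpha < 1, since otherwise c_k >= alpha / k.
   By Vandermonde's identity sum_n (k)_{n,lambda} t^n / n! = e_lambda(t)^k, and
   for small t the absolute version of this sum is at most D^k. Hence the double
   series of c_k (k)_{n,lambda} t^n / n! may be summed in either order, which
   expands e_lambda(alpha e_lambda(t)) in powers of t and identifies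
   e_lambda(alpha) Bel_{n,lambda}(alpha) as sum_k c_k (k)_{n,lambda}. *)
Require Import Defs.
From mathcomp Require Import all_boot all_order all_algebra.
From mathcomp Require Import all_classical all_reals all_analysis.
From mathcomp Require Import measurable_realfun ring lra.
Import Order.TTheory GRing.Theory Num.Theory.
Import numFieldNormedType.Exports.

Local Open Scope classical_set_scope.
Local Open Scope ring_scope.

(** * Real series: exchange of iterated sums and Cauchy products *)

Section series_facts.
Variable R : realType.
Implicit Types (u v : nat -> R) (a : nat -> nat -> R).

Lemma cvg_seriesD u v (l m : R) : series u @ \oo --> l -> series v @ \oo --> m ->
  series (fun n => u n + v n) @ \oo --> l + m.
Proof. by move=> ul vm; rewrite -[fun n => _]/(u + v) seriesD; exact: cvgD. Qed.

Lemma cvg_seriesZ u (c l : R) : series u @ \oo --> l ->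
  series (fun n => c * u n) @ \oo --> c * l.
Proof. 
move=> ul; rewrite (_ : series _ = fun n => c * series u n); last first.
  by apply/funext => n; rewrite /series/= big_distrr.
exact: cvgMl_tmp.
Qed.

Lemma cvg_seriesB u v (l m : R) : series u @ \oo --> l -> series v @ \oo --> m ->
  series (fun n => u n - v n) @ \oo --> l - m.
Proof.
move=> ul /(cvg_seriesZ _ (-1)) vm; rewrite -mulN1r.
under eq_fun do rewrite -mulN1r.
exact: cvg_seriesD.
Qed.

Lemma nneg_series_le_lim u (l : R) N : (forall n, 0 <= u n) ->
  series u @ \oo --> l -> series u N <= l.
Proof.
move=> u0 ul; rewrite -(cvg_lim (@Rhausdorff R) ul).
apply: nondecreasing_cvgn_le; last by apply/cvg_ex; exists l.
by apply/nondecreasing_seqP => n; rewrite seriesSr ?lerDl.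
Qed.

Lemma nneg_series_bounded_cvg u (M : R) : (forall n, 0 <= u n) ->
  (forall N, series u N <= M) -> exists2 l : R, series u @ \oo --> l & l <= M.
Proof.
move=> u0 uM; have cu : cvgn (series u).
  apply: nondecreasing_is_cvgn; last by exists M => _ [N _ <-].
  by apply/nondecreasing_seqP => n; rewrite seriesSr ?lerDl.
exists (limn (series u)) => //.
by apply: limr_le => //; near=> n; exact: uM.
Unshelve. all: by end_near. Qed.

Lemma nneg_term_le_lim u (l : R) N : (forall n, 0 <= u n) ->
  series u @ \oo --> l -> u N <= l.
Proof.
move=> u0 ul; apply: le_trans (nneg_series_le_lim _ _ N.+1 u0 ul).
by rewrite seriesSr lerDr; apply: sumr_ge0.
Qed.

(* Only one inequality between the two iterated sums is needed here: exchanging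
   the indices gives the other one. *)
Lemma nneg_double_series_le a (s : nat -> R) (S : R) :
  (forall k n, 0 <= a k n) -> (forall k, series (a k) @ \oo --> s k) ->
  series s @ \oo --> S ->
  exists (r : nat -> R) (S' : R), [/\ forall n, series (a^~ n) @ \oo --> r n,
    series r @ \oo --> S' & S' <= S].
Proof.
move=> a0 aks sS.
have s0 k : 0 <= s k by apply: le_trans (nneg_term_le_lim _ _ 0 (a0 k) (aks k)).
have ca n : cvgn (series (a^~ n)).
  apply: (@series_le_cvg _ _ s) => // [k|].
    exact: nneg_term_le_lim (aks k).
  by apply/cvg_ex; exists S.
pose r n := limn (series (a^~ n)).
have r0 n : 0 <= r n.
  by apply: limr_ge => //; near=> N; exact: sumr_ge0.
have [S' rS' S'S] : exists2 l, series r @ \oo --> l & l <= S.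
  apply: nneg_series_bounded_cvg => // N.
  (* [series r N] is the limit in [K] of the sums over rectangles of size [K] by [N], and each of
     these is at most [S]. *)
  have cN : (fun K => \sum_(0 <= n < N) series (a^~ n) K) @ \oo --> series r N.
    by apply: cvg_big => [|n _]; [exact: add_continuous|exact: ca].
  rewrite -(cvg_lim (@Rhausdorff R) cN); apply: limr_le.
    by apply/cvg_ex; eexists; exact: cN.
  near=> K; rewrite exchange_big/=.
  apply: le_trans (nneg_series_le_lim _ _ K s0 sS).
  by apply: ler_sum => k _; exact: nneg_series_le_lim.
by exists r, S'.
Unshelve. all: by end_near. Qed.

Lemma nneg_double_series a (s : nat -> R) (S : R) :
  (forall k n, 0 <= a k n) -> (forall k, series (a k) @ \oo --> s k) ->
  series s @ \oo --> S ->
  exists2 r : nat -> R, forall n, series (a^~ n) @ \oo --> r n & series r @ \oo --> S.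
Proof.
move=> a0 aks sS; have [r [S' [ar rS' S'S]]] := nneg_double_series_le _ _ _ a0 aks sS.
have [s' [S'' [as' s'S'' S''S']]] :=
  nneg_double_series_le (fun n k => a k n) _ _ (fun n k => a0 k n) ar rS'.
have ss' : s' = s.
  by apply/funext => k; exact: (cvg_unique (@Rhausdorff R) (as' k) (aks k)).
have SS'' : S'' = S.
  by apply: (cvg_unique (@Rhausdorff R) s'S''); rewrite ss'.
exists r => //; suff -> : S = S' by [].
by apply/eqP; rewrite eq_le S'S -SS'' S''S'.
Qed.

Lemma abs_double_series a (s : nat -> R) (S : R) :
  (forall k, series (fun n => `|a k n|) @ \oo --> s k) ->
  series s @ \oo --> S ->
  exists (u r : nat -> R) (T : R), [/\ forall k, series (a k) @ \oo --> u k, series u @ \oo --> T,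
    forall n, series (a^~ n) @ \oo --> r n & series r @ \oo --> T].
Proof.
move=> aks sS.
have [r1 ar1 r1S] := nneg_double_series (fun k n => `|a k n|) _ _
  (fun k n => normr_ge0 _) aks sS.
have cak k : cvgn (series (a k)).
  by apply: normed_cvg; apply/cvg_ex; exists (s k); exact: aks.
pose u k := limn (series (a k)).
have au k : series (a k) @ \oo --> u k by exact: cak.
have us k : `|u k| <= s k.
  rewrite -(cvg_lim (@Rhausdorff R) (aks k)).
  by apply: lim_series_norm; apply/cvg_ex; exists (s k); exact: aks.
have [T uT] : exists T : R, series u @ \oo --> T.
  apply/cvg_ex; apply: normed_cvg; apply: (@series_le_cvg _ _ s) => //.
  - by move=> k /=.
  - by move=> k; apply: le_trans (us k).
    by apply/cvg_ex; exists S.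
(* [a = (a + `|a|) - `|a|] reduces the signed case to the nonnegative one. *)
have [k n|k||r2 ar2 r2S] := nneg_double_series (fun k n => a k n + `|a k n|)
  (fun k => u k + s k) (T + S).
- by have := ler_norm (- a k n); rewrite normrN; lra.
- exact: cvg_seriesD.
- exact: cvg_seriesD.
exists u, (fun n => r2 n - r1 n), T; split => //.
- move=> n; rewrite (_ : a^~ n = fun k => (a k n + `|a k n|) - `|a k n|).
    exact: cvg_seriesB.
  by apply/funext => k; rewrite addrK.
- by rewrite -(addrK S T); exact: cvg_seriesB.
Qed.

Lemma finite_support_series_cvg u N : (forall n, (N <= n)%N -> u n = 0) ->
  series u @ \oo --> series u N.
Proof.
move=> uN; apply: cvg_near_cst; near=> n.
have Nn : (N <= n)%N by near: n; exact: nbhs_infty_ge.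
rewrite /series/= (@big_cat_nat _ _ _ N)//= [X in _ + X]big1_seq ?addr0//.
by move=> i /andP[_]; rewrite mem_index_iota => /andP[Ni _]; exact: uN.
Unshelve. all: by end_near. Qed.

Lemma series_drop u N (l : R) : series u @ \oo --> l ->
  series (fun n => u (n + N)%N) @ \oo --> l - series u N.
Proof.
move=> ul; rewrite (_ : series _ = fun n => series u (n + N)%N - series u N).
  by apply: cvgB; [rewrite -(cvg_shiftn N) in ul|exact: cvg_cst].
apply/funext => n; elim: n => [|n IH].
  by rewrite add0n subrr /series/= big_geq.
by rewrite seriesSr IH addSn [in RHS]seriesSr addrAC.
Qed.

Lemma series_shift u i (l : R) : series u @ \oo --> l ->
  series (fun n => if (i <= n)%N then u (n - i)%N else 0) @ \oo --> l.
Proof.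
move=> ul; rewrite (_ : series _ = fun n => series u (n - i)%N).
  by rewrite -(cvg_centern i) in ul.
apply/funext; elim=> [|n IH]; first by rewrite sub0n /series/= !big_geq.
rewrite seriesSr; set s := series _ in IH *; rewrite IH.
case: leqP => ni; first by rewrite subSn// seriesSr.
by rewrite addr0 (eqP (ni : n.+1 - i == 0)%N) (eqP (ltnW ni : n - i == 0)%N).
Qed.

(** Row [i] holds the products with [u i], moved right by [i] places: the rows sum to [u i * lv],
    the columns are the finite convolutions, and absolute convergence makes both orders of summation
    agree. *)
Lemma cauchy_product u v (lu lv su sv : R) :
  series (fun n => `|u n|) @ \oo --> su -> series (fun n => `|v n|) @ \oo --> sv ->
  series u @ \oo --> lu -> series v @ \oo --> lv ->
  series (fun n => \sum_(i < n.+1) u i * v (n - i)%N) @ \oo --> lu * lv.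
Proof.
move=> usu vsv ulu vlv.
pose a i n := u i * (if (i <= n)%N then v (n - i)%N else 0).
have [||u' [r [T [au' u'T ar rT]]]] := abs_double_series a (fun i => `|u i| * sv) (su * sv).
- move=> i; rewrite [X in series X](_ : _ =
      fun n => `|u i| * (if (i <= n)%N then `|v (n - i)%N| else 0)).
    by apply: cvg_seriesZ; exact: (series_shift (fun n => `|v n|)).
  by apply/funext => n; rewrite normrM; case: ifP; rewrite ?normr0.
- by under eq_fun do rewrite mulrC; rewrite mulrC; exact: cvg_seriesZ.
have u'E i : u' i = u i * lv.
  apply: (cvg_unique (@Rhausdorff R) (au' i)).
  by apply: cvg_seriesZ; exact: series_shift.
have rE n : r n = \sum_(i < n.+1) u i * v (n - i)%N.
  apply: (cvg_unique (@Rhausdorff R) (ar n)).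
  rewrite (_ : \sum_(i < n.+1) _ = series (a^~ n) n.+1).
    by apply: finite_support_series_cvg => k nk; rewrite /a leqNgt nk mulr0.
  rewrite /series/= big_mkord; apply: eq_bigr => i _.
  by rewrite /a -ltnS ltn_ord.
rewrite (_ : lu * lv = T).
  by rewrite (_ : (fun n => _) = r)//; apply/funext => n; rewrite rE.
apply/esym; apply: (cvg_unique (@Rhausdorff R) u'T).
rewrite (_ : u' = fun i => lv * u i); last by apply/funext => i; rewrite u'E mulrC.
by rewrite mulrC; exact: cvg_seriesZ.
Qed.

End series_facts.

(** * The degenerate exponential series and its natural powers *)

Definition dexp_term {R : realType} (lambda x t : R) (n : nat) : R :=
  dfalling lambda x n * (t ^+ n / n`!%:R).

Section degenerate_exponential.
Variable R : realType.
Implicit Types (lambda x y t : R).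

Lemma dfallingS lambda x n :
  dfalling lambda x n.+1 = dfalling lambda x n * (x - n%:R * lambda).
Proof. by rewrite /dfalling big_ord_recr. Qed.

Lemma dexp_term0 lambda x t : dexp_term lambda x t 0 = 1.
Proof. by rewrite /dexp_term /dfalling big_ord0 expr0 fact0 divr1 mulr1. Qed.

(** This first-order recurrence stands in for factorials and falling products in the later
    inductions and comparisons. *)
Lemma dexp_termS lambda x t n :
  n.+1%:R * dexp_term lambda x t n.+1 =
  t * (x - n%:R * lambda) * dexp_term lambda x t n.
Proof.
rewrite /dexp_term dfallingS exprS factS natrM.
have n0 : n`!%:R != 0 :> R by rewrite pnatr_eq0 -lt0n fact_gt0.
have n1 : n.+1%:R != 0 :> R by rewrite pnatr_eq0.
by field; rewrite n0 addrC natr1 n1.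
Qed.

(** Vandermonde's identity with the factorials absorbed into the terms; it follows from the
    recurrence by induction on [n]. *)
Lemma dexp_termD lambda x y t n : dexp_term lambda (x + y) t n =
  \sum_(i < n.+1) dexp_term lambda x t i * dexp_term lambda y t (n - i).
Proof.
elim: n => [|n IH]; first by rewrite big_ord1 !dexp_term0 mulr1.
have n1 : n.+1%:R != 0 :> R by rewrite pnatr_eq0.
apply: (mulfI n1); rewrite dexp_termS IH !mulr_sumr.
(* The factor n+1 is split as i + (n+1-i), so that the recurrence applies to one factor in each
   half. After reindexing, (x - i lambda) + (y - (n-i) lambda) = x + y - n lambda recombines
   them. *)
rewrite [RHS](eq_bigr (fun i : 'I_n.+2 =>
   (i%:R * dexp_term lambda x t i) * dexp_term lambda y t (n.+1 - i) +
   dexp_term lambda x t i *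
     ((n.+1 - i)%:R * dexp_term lambda y t (n.+1 - i)))); last first.
  by move=> i _; rewrite natrB -1?ltnS//; ring.
rewrite big_split/= [X in _ = X + _]big_ord_recl/= !mul0r add0r.
rewrite [X in _ = _ + X]big_ord_recr/= subnn mul0r mulr0 addr0 -big_split/=.
apply: eq_bigr => i _; have ni : (i <= n)%N by rewrite -ltnS.
rewrite /bump/= add1n subSS dexp_termS subSn// dexp_termS natrB//; ring.
Qed.

(** Each factor satisfies |x - i lambda| <= |x| + i |lambda|, so the parameter -|lambda| provides a
    nonnegative majorant. *)
Lemma dexp_term_norm_le lambda x t n :
  `|dexp_term lambda x t n| <= dexp_term (- `|lambda|) `|x| `|t| n.
Proof.
rewrite /dexp_term !normrM normfV normrX [`|n`!%:R|]ger0_norm//.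
apply: ler_wpM2r; first by rewrite mulr_ge0 ?invr_ge0// exprn_ge0.
rewrite normr_prod; apply: ler_prod => i _; rewrite normr_ge0/= mulrN opprK.
by apply: le_trans (ler_normB _ _) _; rewrite normrM [`|i%:R|]ger0_norm.
Qed.

Lemma dexp_term_ge0 mu x t n : 0 <= mu -> 0 <= x -> 0 <= t ->
  0 <= dexp_term (- mu) x t n.
Proof.
move=> mu0 x0 t0; rewrite mulr_ge0// ?mulr_ge0 ?invr_ge0 ?exprn_ge0//.
by apply: prodr_ge0 => i _; rewrite mulrN opprK addr_ge0// mulr_ge0.
Qed.

Lemma dexp_term_0x lambda t n : dexp_term lambda 0 t n = (n == 0%N)%:R.
Proof.
case: n => [|n]; first by rewrite dexp_term0.
by rewrite /dexp_term /dfalling big_ord_recl/= mul0r subrr !mul0r.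
Qed.

(** The ratio of consecutive terms is t (1 + n mu) / (n+1), which is at most (1 + mu) t. *)
Lemma dexp_term_geometric_le mu t n : 0 <= mu -> 0 <= t ->
  dexp_term (- mu) 1 t n <= geometric 1 ((1 + mu) * t) n.
Proof.
move=> mu0 t0; elim: n => [|n IH]; first by rewrite dexp_term0 /= expr0 mulr1.
have n1 : 0 < n.+1%:R :> R by rewrite ltr0n.
rewrite -(ler_pM2l n1) dexp_termS /= mul1r exprS [leRHS]mulrA.
have n0 : 0 <= n%:R :> R by [].
apply: ler_pM.
- by rewrite mulrN opprK mulr_ge0// addr_ge0// mulr_ge0.
- exact: dexp_term_ge0.
- by rewrite -natr1; nra.
- by move: IH; rewrite /= mul1r.
Qed.

Lemma dexp_majorant_cvg mu t : 0 <= mu -> 0 <= t -> (1 + mu) * t < 1 ->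
  exists2 E : R, series (dexp_term (- mu) 1 t) @ \oo --> E &
    1 <= E <= (1 - (1 + mu) * t)^-1.
Proof.
move=> mu0 t0 mut.
have q0 : 0 <= (1 + mu) * t by rewrite mulr_ge0// addr_ge0.
have geo : series (geometric 1 ((1 + mu) * t)) @ \oo --> (1 - (1 + mu) * t)^-1.
  by rewrite -[_^-1]mul1r; apply: cvg_geometric_series; rewrite ger0_norm.
have [n|N|E cE Ele] := nneg_series_bounded_cvg R (dexp_term (- mu) 1 t)
  (1 - (1 + mu) * t)^-1.
- exact: dexp_term_ge0.
- apply: le_trans (nneg_series_le_lim _ _ _ N _ geo); last by move=> n; exact: geometric_ge0.
  by apply: ler_sum => n _; exact: dexp_term_geometric_le.
exists E => //; rewrite Ele andbT -(dexp_term0 (- mu) 1 t).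
by apply: nneg_term_le_lim cE => n; exact: dexp_term_ge0.
Qed.

(** A [k]-fold Cauchy product, through Vandermonde's identity. This nonnegative case supplies the
    bound on absolute sums in the signed case. *)
Lemma dexp_term_nat_ge0_cvg mu t (E : R) k : 0 <= mu -> 0 <= t ->
  series (dexp_term (- mu) 1 t) @ \oo --> E ->
  series (dexp_term (- mu) k%:R t) @ \oo --> E ^+ k.
Proof.
move=> mu0 t0 cE; elim: k => [|k IH].
  rewrite expr0 (_ : 1 = series (dexp_term (- mu) 0 t) 1); last first.
    by rewrite /series/= big_nat1 dexp_term0.
  by apply: finite_support_series_cvg => -[|n]// _; rewrite dexp_term_0x.
have nn x : 0 <= x -> (fun n => `|dexp_term (- mu) x t n|) = dexp_term (- mu) x t.
  by move=> x0; apply/funext => n; rewrite ger0_norm// dexp_term_ge0.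
rewrite -natr1 exprSr; rewrite (funext (dexp_termD _ _ _ _)).
by apply: cauchy_product; [rewrite nn//; exact: IH|rewrite nn//; exact: cE|..].
Qed.

Lemma dexp_term_nat_cvg lambda t (E : R) k :
  series (dexp_term (- `|lambda|) 1 `|t|) @ \oo --> E ->
  [/\ cvgn (series (fun n => `|dexp_term lambda k%:R t n|)),
      limn (series (fun n => `|dexp_term lambda k%:R t n|)) <= E ^+ k &
      series (dexp_term lambda k%:R t) @ \oo --> (dexp lambda t) ^+ k].
Proof.
move=> cE.
have cEk j := dexp_term_nat_ge0_cvg _ _ _ j (normr_ge0 lambda) (normr_ge0 t) cE.
have abs_le j n : `|dexp_term lambda j%:R t n| <= dexp_term (- `|lambda|) j%:R `|t| n.
  by rewrite -[j%:R in leRHS]ger0_norm//; exact: dexp_term_norm_le.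
have cabs j : cvgn (series (fun n => `|dexp_term lambda j%:R t n|)).
  apply: (@series_le_cvg _ _ (dexp_term (- `|lambda|) j%:R `|t|)) => //.
    by move=> n; exact: dexp_term_ge0.
  by apply/cvg_ex; exists (E ^+ j); exact: cEk.
split=> //.
  rewrite -(cvg_lim (@Rhausdorff R) (cEk k)); apply: lim_series_le => //.
  by apply/cvg_ex; exists (E ^+ k); exact: cEk.
elim: k => [|k IH].
  rewrite expr0 (_ : 1 = series (dexp_term lambda 0 t) 1); last first.
    by rewrite /series/= big_nat1 dexp_term0.
  by apply: finite_support_series_cvg => -[|n]// _; rewrite dexp_term_0x.
have c1 : series (dexp_term lambda 1 t) @ \oo --> dexp lambda t.
  exact: (normed_cvg (cabs 1%N)).
rewrite -natr1 exprSr; rewrite (funext (dexp_termD _ _ _ _)).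
by apply: cauchy_product; [exact: cabs k|exact: cabs 1%N|..].
Qed.

End degenerate_exponential.

(** * Ratio test and uniqueness of power series coefficients *)

Section power_series.
Variable R : realType.

Lemma ratio_test (u : nat -> R) (q : R) K : (forall n, 0 <= u n) -> q < 1 ->
  (forall n, (K <= n)%N -> u n.+1 <= q * u n) -> cvgn (series u).
Proof.
move=> u0 q1 uq; have q0 : 0 < 1 - q by rewrite subr_gt0.
(* [u n / (1 - q)] bounds the geometric tail, so this potential decreases. *)
have dec n : series u (K + n)%N + u (K + n)%N / (1 - q) <= series u K + u K / (1 - q).
  elim: n => [|n]; first by rewrite addn0.
  apply: le_trans; rewrite addnS seriesSr -addrA lerD2l.
  apply: le_trans (_ : u (K + n)%N + q * u (K + n)%N / (1 - q) <= _).
    by rewrite lerD2l ler_wpM2r ?invr_ge0 ?(ltW q0)// uq// leq_addr.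
  rewrite le_eqVlt; apply/orP; left; apply/eqP; field.
  by rewrite gt_eqF.
have [N|l cl _] := nneg_series_bounded_cvg _ _ (series u K + u K / (1 - q)) u0.
  apply: le_trans (dec N); apply: (@le_trans _ _ (series u (K + N)%N)).
    by apply: nondecreasing_series => //; exact: leq_addl.
  by rewrite lerDl divr_ge0// ltW.
by apply/cvg_ex; exists l.
Qed.

(** If [a m] were the first nonzero coefficient, then at a point [q * t0] close enough to 0 its term
    would exceed a geometric bound on the whole remaining tail, and the sum could not vanish. *)
Lemma power_series_eq0 (a : nat -> R) :
  (\forall t \near (0 : R), series (fun n => a n * t ^+ n) @ \oo --> (0 : R)) ->
  forall n, a n = 0.
Proof.
move=> /nbhs_ballP[e /= e0 ae].
pose t0 := e / 2; have t0_gt0 : 0 < t0 by rewrite divr_gt0.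
have at0 t : 0 <= t <= t0 -> series (fun n => a n * t ^+ n) @ \oo --> (0 : R).
  move=> /andP[t_ge0 tt0]; apply: ae; rewrite /ball/= sub0r normrN ger0_norm//.
  by apply: le_lt_trans tt0 _; rewrite /t0; lra.
have [M M0 aM] : exists2 M : R, 0 <= M & forall n, `|a n| * t0 ^+ n <= M.
  have c0 : cvgn (series (fun n => a n * t0 ^+ n)).
    by apply/cvg_ex; exists 0; apply: at0; rewrite ltW/=.
  have [M aM] := cvg_has_ub (cvgP _ (cvg_series_cvg_0 c0)).
  exists `|M| => // n; apply: le_trans (ler_norm M).
  by rewrite -{1}(ger0_norm (ltW t0_gt0)) -normrX -normrM; apply: aM; exists n.
elim/ltn_ind => m IH; apply/eqP; rewrite -normr_eq0; apply/negPn/negP => am0.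
set A := `|a m| * t0 ^+ m.
have A0 : 0 < A by rewrite mulr_gt0 ?exprn_gt0// lt_def am0/=.
(* This choice gives q <= 1/4 and 2 M q < A, hence M q / (1 - q) < A: the tail after index [m] is
   smaller than the term at [m]. *)
pose q := A / (4 * (A + M + 1)).
have q0 : 0 < q by rewrite divr_gt0//; lra.
have q4 : q <= 4^-1 by rewrite ler_pdivrMr; lra.
have Mq : 2 * M * q < A.
  by rewrite /q mulrA ltr_pdivrMr; nra.
clearbody q; have ct := at0 (q * t0) _.
have {}ct : series (fun n => a n * (q * t0) ^+ n) @ \oo --> (0 : R).
  by apply: ct; rewrite mulr_ge0 ?(ltW q0) ?(ltW t0_gt0)//= ler_piMl ?(ltW t0_gt0)//; lra.
have := series_drop _ _ m.+1 _ ct.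
rewrite seriesSr sub0r (_ : series _ m = 0) ?add0r; last first.
  by rewrite /series/= big_nat big1// => i im; rewrite IH ?mul0r.
move=> cm.
have geo : series (geometric (M * q ^+ m.+1) q) @ \oo --> M * q ^+ m.+1 / (1 - q).
  by apply: cvg_geometric_series; rewrite ger0_norm; lra.
have le_geo n : `|a (n + m.+1)%N * (q * t0) ^+ (n + m.+1)| <=
    geometric (M * q ^+ m.+1) q n.
  rewrite /= normrM [X in _ * X <= _]ger0_norm; last by rewrite exprn_ge0// mulr_ge0// ltW.
  rewrite exprMn mulrCA [leRHS](_ : _ = q ^+ (n + m.+1) * M); last first.
    by rewrite exprD; ring.
  by rewrite ler_pM2l ?exprn_gt0.
have cabs : cvgn (series (fun n => `|a (n + m.+1)%N * (q * t0) ^+ (n + m.+1)|)).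
  apply: (series_le_cvg _ _ le_geo) => //.
    by move=> n; apply: le_trans (le_geo n).
  by apply/cvg_ex; eexists; exact: geo.
have := lim_series_norm cabs; rewrite (cvg_lim (@Rhausdorff R) cm) normrN.
apply/negP; rewrite -ltNge.
apply: (@le_lt_trans _ _ (M * q ^+ m.+1 / (1 - q))).
  rewrite -(cvg_lim (@Rhausdorff R) geo); apply: lim_series_le => //.
  by apply/cvg_ex; eexists; exact: geo.
rewrite normrM [X in _ < _ * X]ger0_norm; last by rewrite exprn_ge0// mulr_ge0// ltW.
rewrite exprMn mulrCA -/A exprS ltr_pdivrMr; last lra.
rewrite [X in X < _](_ : _ = q ^+ m * (M * q)); last by ring.
rewrite -mulrA ltr_pM2l ?exprn_gt0//; nra.
Qed.

End power_series.

(** * Dobinski's formula for the degenerate Bell polynomials *)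

Section degenerate_bell.
Variables (R : realType) (lambda alpha : R).
Hypothesis alpha_gt0 : 0 < alpha.
Let c := dexp_term lambda 1 alpha.
Hypothesis c_ge0 : forall k, 0 <= c k.
Hypothesis c_cvg : cvgn (series c).

(* Past 1 / lambda the factors 1 - k lambda are negative, so a positive term
   would be followed by a negative one. *)
Let finite_support : 0 < lambda -> exists N, forall k, (N <= k)%N -> c k = 0.
Proof.
move=> lambda_gt0; pose N := Num.bound lambda^-1.
have N1 : 1 - N%:R * lambda < 0.
  rewrite subr_lt0 -ltr_pdivrMr// div1r.
  by have := archi_boundP (ltW (_ : 0 < lambda^-1)); rewrite invr_gt0; exact.
have cN : c N = 0.
  apply/eqP; rewrite eq_le c_ge0 andbT.
  have := dexp_termS R lambda 1 alpha N.
  have : 0 <= N.+1%:R * c N.+1 by rewrite mulr_ge0.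
  rewrite /c => + e; rewrite e -mulrA pmulr_rge0// nmulr_rge0//.
exists N => k /subnK <-; elim: (k - N)%N => [|i IH]; first by rewrite add0n.
apply: (@mulfI _ (i + N).+1%:R); first by rewrite pnatr_eq0.
by rewrite addSn [LHS]dexp_termS -/c IH !mulr0.
Qed.

(* Otherwise [c] would dominate a multiple of the harmonic series. *)
Let subcritical : lambda <= 0 -> - lambda * alpha < 1.
Proof.
move=> lambda_le0; rewrite ltNge; apply/negP => ge1.
(* By the recurrence, (k+2) c_{k+2} = (alpha + (k+1)(-lambda alpha)) c_{k+1} >= (k+1) c_{k+1}; these
   products start at c_1 = alpha and never decrease. *)
have lb k : alpha <= k.+1%:R * c k.+1.
  elim: k => [|k IH].
    by rewrite /c dexp_termS dexp_term0 mul0r subr0 !mulr1.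
  apply: le_trans IH _; rewrite [leRHS]dexp_termS -/c ler_wpM2r//.
  have := ler_wpM2l (ler0n R k.+1) ge1; nra.
apply: (@dvg_harmonic R).
apply: (@series_le_cvg _ _ (fun k => alpha^-1 * c (k + 1)%N)).
- by move=> n; exact: harmonic_ge0.
- by move=> n; rewrite mulr_ge0// invr_ge0 ltW.
- move=> n; rewrite addn1 /harmonic/= mulrC ler_pdivlMr// mulrC ler_pdivrMr//.
  by rewrite mulrC; exact: lb.
- apply/cvg_ex; eexists; apply: cvg_seriesZ; apply: series_drop; exact: c_cvg.
Qed.

(** For lambda <= 0 the ratio c_{n+1} / c_n = (alpha + n s) / (n+1) tends to s = -lambda alpha < 1,
    which leaves room for some D > 1 with s D < 1. *)
Lemma radius_gt1 : exists2 D, 1 < D & cvgn (series (fun k => c k * D ^+ k)).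
Proof.
have [lambda_le0|lambda_gt0] := leP lambda 0; last first.
  have [N cN] := finite_support lambda_gt0; exists 2; first by lra.
  apply/cvg_ex; eexists; apply: (finite_support_series_cvg _ _ N) => n Nn.
  by rewrite cN ?mul0r.
pose s : R := - lambda * alpha.
have s1 : s < 1 := subcritical lambda_le0.
have s0 : 0 <= s by rewrite mulr_ge0 ?oppr_ge0// ltW.
have sE : s = - lambda * alpha by [].
clearbody s.
(* With this [D], 2 (1 - s D) = (1 - s)(2 - s) > 0. *)
pose D : R := (3 - s) / 2; have D1 : 1 < D by rewrite /D; lra.
have sD : s * D < 1.
  have : 0 < (1 - s) * (2 - s) by apply: mulr_gt0; lra.
  by rewrite /D; lra.
(* For n >= 2 K the part alpha D of the ratio's numerator is at most n (1 - s D) / 2, so the ratio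
   is at most the midpoint (1 + s D) / 2 of s D and 1. *)
clearbody D; exists D => //; pose K := Num.bound (alpha * D / (1 - s * D)).
apply: (@ratio_test _ _ ((1 + s * D) / 2) (2 * K)).
- by move=> n; apply: mulr_ge0 => //; rewrite exprn_ge0//; lra.
- by lra.
move=> n Kn.
have aDn : alpha * D <= n%:R * ((1 - s * D) / 2).
  have : alpha * D / (1 - s * D) < K%:R.
    by apply: archi_boundP; rewrite divr_ge0 ?mulr_ge0 ?(ltW alpha_gt0)//; lra.
  rewrite ltr_pdivrMr; last by lra.
  have : 2 * K%:R <= n%:R :> R by rewrite -natrM ler_nat.
  nra.
have n1 : 0 < n.+1%:R :> R by [].
rewrite -(ler_pM2l n1) [leLHS]mulrA [n.+1%:R * c _]dexp_termS -/c exprS.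
rewrite [leLHS](_ : _ = (alpha * D + n%:R * (s * D)) * (c n * D ^+ n)); last first.
  by rewrite sE; ring.
rewrite [leRHS]mulrA; apply: ler_wpM2r; first by apply: mulr_ge0 => //; rewrite exprn_ge0//; lra.
rewrite -natr1; nra.
Qed.

(** The bound on [t] keeps the majorant sum [E] at most [D], so row [k] has absolute sum at most c_k
    D^k and the double series converges absolutely. *)
Lemma dexp_comp_cvg D t : 1 < D -> cvgn (series (fun k => c k * D ^+ k)) ->
  (1 + `|lambda|) * `|t| <= 1 - D^-1 ->
  exists r : nat -> R,
    [/\ forall n, cvgn (series (fun k => `|c k * dexp_term lambda k%:R t n|)),
      forall n, series (fun k => c k * dexp_term lambda k%:R t n) @ \oo --> r n &
      series r @ \oo --> dexp lambda (alpha * dexp lambda t)].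
Proof.
move=> D1 cD tD; have D0 : 0 < D by apply: lt_trans D1.
have t1 : (1 + `|lambda|) * `|t| < 1.
  by apply: le_lt_trans tD _; rewrite ltrBlDr ltrDl invr_gt0.
have [E cE /andP[E1 ED]] := dexp_majorant_cvg _ _ _ (normr_ge0 lambda) (normr_ge0 t) t1.
have {}ED : E <= D.
  by apply: le_trans ED _; rewrite invf_ple ?posrE ?subr_gt0//; lra.
have cabs k n : `|c k * dexp_term lambda k%:R t n| = c k * `|dexp_term lambda k%:R t n|.
  by rewrite normrM ger0_norm.
pose s k := c k * limn (series (fun n => `|dexp_term lambda k%:R t n|)).
have cs k : series (fun n => `|c k * dexp_term lambda k%:R t n|) @ \oo --> s k.
  rewrite (funext (cabs k)); apply: cvg_seriesZ.
  by have [+ _ _] := dexp_term_nat_cvg _ _ _ _ k cE; exact.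
have s0 k : 0 <= s k.
  by apply: le_trans (nneg_term_le_lim _ _ _ 0 _ (cs k)) => //.
have [S sS] : exists S : R, series s @ \oo --> S.
  apply/cvg_ex; apply: series_le_cvg cD => // k.
    by apply: mulr_ge0 => //; rewrite exprn_ge0// ltW.
  apply: ler_wpM2l => //; have [_ le_E _] := dexp_term_nat_cvg _ _ _ _ k cE.
  by apply: le_trans le_E _; rewrite lerXn2r ?nnegrE//; lra.
have [u [r [T [cu uT cr rT]]]] :=
  abs_double_series _ (fun k n => c k * dexp_term lambda k%:R t n) _ _ cs sS.
(* Row [k] sums to c_k e_lambda(t)^k, which is the [k]-th term of e_lambda(alpha e_lambda(t)). *)
have uE k : u k = dexp_term lambda 1 (alpha * dexp lambda t) k.
  apply: (cvg_unique (@Rhausdorff R) (cu k)).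
  have [_ _ /(cvg_seriesZ _ _ (c k))] := dexp_term_nat_cvg _ _ _ _ k cE.
  rewrite /c /dexp_term exprMn.
  by rewrite [X in _ --> X -> _](_ : _ = dfalling lambda 1 k *
    (alpha ^+ k * dexp lambda t ^+ k / k`!%:R)) //; ring.
exists r; split => //.
- move=> n; apply: (@series_le_cvg _ _ s) => //.
    by move=> k; apply: (nneg_term_le_lim _ _ _ n _ (cs k)).
  by apply/cvg_ex; exists S.
- rewrite (_ : dexp lambda _ = T)//.
  rewrite /dexp /dexpx; apply: (cvg_lim (@Rhausdorff R)).
  by rewrite (funext uE) in uT; exact: uT.
Qed.

Lemma dBellE n : exists2 B : R,
  series (fun k => c k * dfalling lambda k%:R n) @ \oo --> B &
  cvgn (series (fun k => `|c k * dfalling lambda k%:R n|)) /\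
  dBell lambda alpha n = (dexp lambda alpha)^-1 * B.
Proof.
have [D D1 cD] := radius_gt1.
have D0 : 0 < D by apply: lt_trans D1.
have l0 : 0 < 1 + `|lambda| by have := normr_ge0 lambda; lra.
pose tau := (1 - D^-1) / (1 + `|lambda|).
have tau0 : 0 < tau by rewrite divr_gt0// subr_gt0 invf_lt1.
have small t : `|t| <= tau -> (1 + `|lambda|) * `|t| <= 1 - D^-1.
  by rewrite ler_pdivlMr// mulrC.
have factor t k m : c k * dexp_term lambda k%:R t m =
    t ^+ m / m`!%:R * (c k * dfalling lambda k%:R m).
  by rewrite /dexp_term; ring.
have factor' k m : c k * dfalling lambda k%:R m =
    m`!%:R / tau ^+ m * (c k * dexp_term lambda k%:R tau m).
  rewrite factor [RHS]mulrA [X in _ = X * _](_ : _ = 1) ?mul1r//; field.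
  by rewrite pnatr_eq0 -lt0n fact_gt0 expf_neq0// gt_eqF.
have [|r [rabs rcvg _]] := dexp_comp_cvg D tau D1 cD; first by apply: small; rewrite gtr0_norm.
pose B m := m`!%:R / tau ^+ m * r m.
have cB m : series (fun k => c k * dfalling lambda k%:R m) @ \oo --> B m.
  by rewrite (funext (factor'^~ m)); exact: cvg_seriesZ.
exists (B n) => //; split.
  have := rabs n => /cvg_ex[l]; move=> /(cvg_seriesZ _ _ `|n`!%:R / tau ^+ n|) cl.
  by under eq_fun do rewrite factor' normrM; apply/cvg_ex; eexists; exact: cl.
have near_small : \forall t \near (0 : R), `|t| <= tau.
  by apply/nbhs_ballP; exists tau => //= t; rewrite /ball/= sub0r normrN => /ltW.
have egf : dBell_egf lambda alpha (fun m => (dexp lambda alpha)^-1 * B m).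
  apply: filterS near_small => t /small tD.
  have [rt [_ rtcvg rtlim]] := dexp_comp_cvg D t D1 cD tD.
  under eq_fun do rewrite -mulrA.
  apply: cvg_seriesZ; rewrite (_ : (fun m => _) = rt)//; apply/funext => m.
  apply: (cvg_unique (@Rhausdorff R) _ (rtcvg m)).
  by rewrite (funext (fun k => factor t k m)) [B m * _]mulrC; exact: cvg_seriesZ.
(* [xget] must return the sequence just found: any other candidate differs from it by coefficients
   of a power series that vanishes near 0. *)
rewrite /dBell (xget_unique _ egf)// => b' egf'; apply/funext => m.
suff : (b' m - (dexp lambda alpha)^-1 * B m) / m`!%:R = 0.
  by move/eqP; rewrite mulf_eq0 invr_eq0 pnatr_eq0 -[m`! == _]negbK -lt0n fact_gt0 orbF
    subr_eq0 => /eqP.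
apply: (power_series_eq0 R (fun m => (b' m - (dexp lambda alpha)^-1 * B m) / m`!%:R)).
apply: filterS2 egf' egf => t cb' cb.
rewrite -(subrr ((dexp lambda alpha)^-1 * dexp lambda (alpha * dexp lambda t))).
rewrite (_ : (fun _ => _) = fun n => b' n * (t ^+ n / n`!%:R) -
  (dexp lambda alpha)^-1 * B n * (t ^+ n / n`!%:R)).
  exact: cvg_seriesB.
by apply/funext => i; ring.
Qed.

End degenerate_bell.

(** * Total mass and expectations for a law on the positive integers, with [p k] the mass at k+1 *)

Section discrete_expectation.
Context (R : realType) (d : measure_display) (T : measurableType d) (P : probability T R).
Variable X : {RV P >-> R}.
Hypothesis X_nat : {ae P, forall w, exists2 k : nat, (0 < k)%N & X w = k%:R}.
Variable p : nat -> R.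
Hypothesis XP : forall k, P (X @^-1` [set k.+1%:R]) = (p k)%:E.

Let A k : set T := X @^-1` [set k.+1%:R].

Let measurable_A k : measurable (A k).
Proof. by rewrite -[A k]setTI; exact: measurable_funP. Qed.

Let trivIset_A : trivIset setT A.
Proof.
apply/trivIsetP => i j _ _ ij; rewrite -subset0 => w [Ai Aj].
have /eqP : i.+1%:R = j.+1%:R :> R by rewrite -(Ai : X w = _) -(Aj : X w = _).
by rewrite eqr_nat eqSS (negbTE ij).
Qed.

Let measurable_U : measurable (\bigcup_k A k).
Proof. exact: bigcupT_measurable. Qed.

Let negligible_UC : P (~` \bigcup_k A k) = 0%E.
Proof.
apply/negligibleP; first exact: measurableC.
apply: negligibleS X_nat => w Uw [[|k]// _ Xw]; apply: Uw.
by exists k.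
Qed.

Lemma nat_law_total : series p @ \oo --> (1 : R).
Proof.
have PU : P (\bigcup_k A k) = 1%E.
  rewrite -(@probability_setT _ _ _ P) -(setUv (\bigcup_k A k)).
  rewrite measureU ?setICr//; last exact: measurableC.
  by rewrite [X in _ + X]negligible_UC adde0.
have : (fun n => \sum_(0 <= k < n) P (A k))%E @ \oo --> P (\bigcup_k A k).
  exact: (@measure_sigma_additive _ _ _ P A measurable_A trivIset_A).
rewrite PU (_ : (fun n => _) = EFin \o series p); last first.
  by apply/funext => n; rewrite /= /series/= -sumEFin; apply: eq_bigr => k _; exact: XP.
by move/fine_cvgP => [].
Qed.

(** The integral splits over the disjoint events X = k+1, on which f(X) is constant; absolute
    convergence gives the integrability that this splitting needs for a signed [f]. *)
Lemma expectation_series (f : R -> R) (l : R) : measurable_fun setT f ->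
  cvgn (series (fun k => `|f k.+1%:R| * p k)) ->
  series (fun k => f k.+1%:R * p k) @ \oo --> l ->
  ('E_P[(fun w => f (X w))] = l%:E)%E.
Proof.
move=> mf fabs fl.
have mfX : measurable_fun setT (fun w => f (X w)).
  by apply: measurableT_comp.
have mN : measurable (~` \bigcup_k A k) by exact: measurableC.
have int_A (g : R -> R) k : (\int[P]_(w in A k) (g (X w))%:E = (g k.+1%:R * p k)%:E)%E.
  rewrite (@eq_integral _ _ _ _ _ (cst (g k.+1%:R)%:E)); last first.
    by move=> w; rewrite inE => Aw; rewrite (Aw : X w = _).
  by rewrite integral_cst// EFinM; congr (_ * _)%E; exact: XP.
have int_abs : P.-integrable setT (fun w => (f (X w))%:E).
  apply/integrableP; split; first exact/measurable_EFinP.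
  rewrite (ge0_negligible_integral mN)//; last first.
    by apply: measurableT_comp => //; exact/measurable_EFinP.
  rewrite setTD setCK ge0_integral_bigcup//; last first.
    apply: measurable_funTS; apply: measurableT_comp => //; exact/measurable_EFinP.
  rewrite (eq_eseriesr (fun k _ => int_A (fun x => `|f x|) k)).
  have := EFin_lim fabs.
  rewrite (_ : EFin \o _ = fun n => (\sum_(0 <= k < n) (`|f k.+1%:R| * p k)%:E)%E).
    by move=> ->; rewrite ltry.
  by apply/funext => n; rewrite /= /series/= -sumEFin.
rewrite unlock (negligible_integral mN)//.
rewrite setTD setCK integral_bigcup//; last exact: integrableS int_abs.
rewrite (eq_eseriesr (fun k _ => int_A f k)).
rewrite (_ : (fun n => _) = EFin \o series (fun k => f k.+1%:R * p k)).
  by apply: (cvg_lim (@ereal_hausdorff R)); apply: cvg_EFin => //; apply: nearW.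
by apply/funext => n; rewrite /= /series/= -sumEFin.
Qed.

End discrete_expectation.

(** * Falling factorial moments of the zero-truncated law *)

Theorem theorem10 (R : realType) (d : measure_display) (T : measurableType d)
    (P : probability T R) (X : {RV P >-> R}) (lambda alpha : R)
    (alpha_gt0 : 0 < alpha) (HX : zt_degenerate_poisson X lambda alpha)
    (n : nat) (n_gt0 : (0 < n)%N) :
  ('E_P[(fun w => dfalling lambda (X w) n)] =
   ((1 - (dexp lambda alpha)^-1)^-1 * dBell lambda alpha n)%:E)%E.
Proof.
have [X_nat law] := HX.
pose C := (dexp lambda alpha - 1)^-1; pose c := dexp_term lambda 1 alpha.
pose p k := C * c k.+1.
have XP k : P (X @^-1` [set k.+1%:R]) = (p k)%:E.
  by rewrite law// /p /c /dexp_term [dfalling _ _ _ * _]mulrC.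
have p1 := nat_law_total R d T P X X_nat p XP.
have p_ge0 k : 0 <= p k by rewrite -lee_fin -XP.
(* The mass at 1 is C alpha, with alpha > 0. *)
have C_ge0 : 0 <= C.
  have := p_ge0 0%N; rewrite /p /c (_ : dexp_term lambda 1 alpha 1 = alpha).
    by rewrite pmulr_lge0.
  have := dexp_termS R lambda 1 alpha 0.
  by rewrite dexp_term0 !mul1r mul0r subr0 !mulr1.
(* Nothing is known yet about the limit behind [dexp lambda alpha], and the inverse of 0 is 0; the
   total mass 1 excludes this case. *)
have C0 : C != 0.
  apply/eqP => C0.
  have p0 : series p @ \oo --> (0 : R).
    rewrite (_ : series p = cst 0); first exact: cvg_cst.
    by apply/funext => N; rewrite /series/= big1// => i _; rewrite /p C0 mul0r.
  have : (1 : R) = 0 by exact: (cvg_unique (@Rhausdorff R) p1 p0).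
  by move/eqP; rewrite oner_eq0.
have C_gt0 : 0 < C by rewrite lt_def C0.
have cE k : c k.+1 = C^-1 * p k by rewrite /p mulKf.
have c_ge0 k : 0 <= c k.
  case: k => [|k]; first by rewrite /c dexp_term0.
  by rewrite cE; apply: mulr_ge0 => //; rewrite invr_ge0.
have c_cvg : cvgn (series c).
  (* C^-1 p is [c] without its term at 0 and sums to C^-1; the added 1 is c_0, which the truncated
     law does not see. *)
  apply/cvg_ex; exists (C^-1 + 1).
  have := cvg_seriesZ _ _ C^-1 _ p1; rewrite mulr1 => /(series_shift _ _ 1).
  have c0 : series (fun k => (k == 0%N)%:R : R) @ \oo --> (1 : R).
    have h : series (fun k => (k == 0%N)%:R : R) 1 = 1 by rewrite /series/= big_nat1.
    by rewrite -[X in _ --> X]h; apply: finite_support_series_cvg; case.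
  move=> /(cvg_seriesD _ _ _ _ _ c0); rewrite addrC.
  rewrite (_ : (fun k => _) = c)//.
  apply/funext => -[|k] /=; first by rewrite addr0 /c dexp_term0.
  by rewrite add0r subn1 cE.
(* Since n > 0, the term k = 0 of the sum [B] vanishes, so truncation at zero loses nothing. *)
have f0 : dfalling lambda 0 n = 0 :> R.
  by case: n n_gt0 => // m _; rewrite /dfalling big_ord_recl mul0r subrr mul0r.
have [B cB [cabs ->]] := dBellE R lambda alpha alpha_gt0 c_ge0 c_cvg n.
have e_neq0 : dexp lambda alpha - 1 != 0 by rewrite -invr_eq0.
have e_gt1 : 1 < dexp lambda alpha by rewrite -subr_gt0 -invr_gt0.
have mf : measurable_fun setT (fun x : R => dfalling lambda x n).
  apply: measurable_prod => i _; apply: measurable_funB; first exact: measurable_id.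
  exact: measurable_cst.
have EE := expectation_series R d T P X X_nat p XP (fun x => dfalling lambda x n) (C * B) mf.
rewrite EE.
(* With e = e_lambda(alpha) > 1, this is 1 / (e - 1) = e^-1 / (1 - e^-1). *)
- congr EFin; rewrite /C; field; rewrite e_neq0 gt_eqF//=; lra.
- move/cvg_ex: cabs => [l] /(series_drop _ _ 1)/(cvg_seriesZ _ _ C) cl.
  apply/cvg_ex; eexists; move: cl; rewrite [X in series X @ _](_ : _ = fun k => `|dfalling lambda k.+1%:R n| * p k); first exact.
  by apply/funext => k; rewrite addn1 normrM ger0_norm// /p -/c; ring.
- move: cB => /(series_drop _ _ 1)/(cvg_seriesZ _ _ C).
  rewrite [series _ 1]big_nat1 f0 mulr0 subr0.
  rewrite [X in series X @ _](_ : _ = fun k => dfalling lambda k.+1%:R n * p k)//.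
  by apply/funext => k; rewrite addn1 /p /c; ring.
Qed.
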